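(* Let $f_0(x)=\lceil\log_2 x\rceil$ and let $r$ be a positive integer. There exists a polynomial $P_r$ such that for every finite simple graph $G$, $$N_{f_0}(G,r)\le P_r\big(\widetilde\nabla_{2^r}(G)\big).$$
   Context: For a finite simple graph $G$, a function $f:\mathbb{N}\to\mathbb{N}$ and a positive integer $p$, $N_f(G,p)$ denotes the minimum number of colours in a colouring of the edges of $G$ such that every cycle $\gamma$ of $G$ receives at least $\min(f(|\gamma|),p+1)$ distinct colours, where $|\gamma|$ is the length of $\gamma$. For a half-integer $r\ge 0$, a simple graph $H$ is a shallow topological minor of $G$ at depth $r$ if some $\le 2r$-subdivision of $H$ (each edge replaced by a path with at most $2r$ internal vertices, the paths being internally vertex-disjoint) is a subgraph of $G$; $\widetilde\nabla_r(G)$ is the maximum of $\|H\|/|H|$ over all such simple graphs $H$. *)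

(* Defs.v *)
From HB Require Import structures.
From mathcomp Require Import all_boot all_order all_algebra.
Set Implicit Arguments. Unset Strict Implicit. Unset Printing Implicit Defensive.
Import Order.TTheory GRing.Theory Num.Theory.

Definition simple_graph (T : finType) (e : rel T) : Prop :=
  symmetric e /\ irreflexive e.

Definition edge_set (T : finType) (e : rel T) : {set {set T}} :=
  [set A : {set T} | [exists x, exists y, e x y && (A == [set x; y])]].

Definition ncolours (T : finType) (e : rel T) (col : {set T} -> nat) : nat :=
  size (undup [seq col A | A <- enum (edge_set e)]).

Definition is_graph_cycle (T : finType) (e : rel T) (c : seq T) : Prop :=
  [/\ cycle e c, uniq c & 2 < size c].

Definition cycle_colours (T : finType) (col : {set T} -> nat) (c : seq T) : nat :=
  size (undup [seq col [set x; next c x] | x <- c]).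

(* col is admissible for N_f(G,p): every cycle gets >= min(f |cycle|, p+1) colours. *)
Definition admissible_colouring (T : finType) (e : rel T) (f : nat -> nat) (p : nat)
  (col : {set T} -> nat) : Prop :=
  forall c : seq T, is_graph_cycle e c -> minn (f (size c)) p.+1 <= cycle_colours col c.

Definition f0 (n : nat) : nat := up_log 2 n.

(* A <=k-subdivision of the simple graph (H,h) is a subgraph of (T,e):
   branch vertices phi (injective), for each edge uv of H a path in G from
   phi u to phi v whose internal vertices p u v (at most k, distinct) avoid the
   branch vertices, and internal vertices of paths of distinct edges are disjoint. *)
Definition subdivision_subgraph (H : finType) (h : rel H) (T : finType) (e : rel T)
  (k : nat) : Prop :=
  exists (phi : H -> T) (p : H -> H -> seq T),
    [/\ injective phi,
        (forall u v, h u v ->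
           [/\ path e (phi u) (rcons (p u v) (phi v)), uniq (p u v),
               size (p u v) <= k & forall z w, z \in p u v -> z != phi w]) &
        (forall u v u' v', h u v -> h u' v' -> [set u; v] != [set u'; v'] ->
           forall z, z \in p u v -> z \notin p u' v')].

Definition shallow_top_minor (H : finType) (h : rel H) (T : finType) (e : rel T)
  (d : nat) : Prop :=
  subdivision_subgraph h e (2 * d).

(* ||H|| / |H|  (in rat; equals 0 for the empty graph, as 0/0 = 0 in mathcomp). *)
Definition density (H : finType) (h : rel H) : rat :=
  ((#|edge_set h|)%:R / (#|H|)%:R)%R.

Definition is_top_grad (T : finType) (e : rel T) (d : nat) (x : rat) : Prop :=
  (exists (H : finType) (h : rel H),
      [/\ simple_graph h, shallow_top_minor h e d & density h = x]) /\
  (forall (H : finType) (h : rel H),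
      simple_graph h -> shallow_top_minor h e d -> (density h <= x)%R).

(* Main.v *)
Require Import Defs.
From HB Require Import structures.
From mathcomp Require Import all_boot all_order all_algebra.
From mathcomp Require Import zify.
From Stdlib Require Import Classical_Prop.
Import Order.TTheory GRing.Theory Num.Theory.
Set Implicit Arguments. Unset Strict Implicit. Unset Printing Implicit Defensive.

(** Put [k = 2 ^ r] and let [D] be an integer upper bound for the topological
    grad of [G] at depth [k].

    Every nonempty [S] contains a vertex [w] such that polynomially many (in
    [D]) vertices other than [w] meet all paths of length at most [k] from [w]
    to the rest of [S]. Otherwise take a maximal family of internally disjoint
    paths with at most [2k] internal vertices, all outside [S], joining
    distinct pairs of [S]; let [M] be [S] together with these internal vertices
    and [I] a subset of [S] of proportional size no two elements of which are
    joined. Each [w] in [I] has a large fan of paths to [M], and by maximality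
    fans of different vertices are disjoint outside [M], so that they form a
    too dense shallow topological minor on [M].

    Removing such vertices [w] one at a time gives a ranking of the vertices
    with blocking sets [X w]. A vertex [u] that is lowest on a path of length at
    most [k] from [v] to [u] is reached from [v] by at most [k] steps
    [x -> y], [y] in [X x]; a greedy colouring [c] therefore makes the colour of
    the lowest vertex of any path of length at most [k] unique on this path.
    Give every edge the colour of its lower end. Deleting the lowest vertex of a
    path with [n <= k + 1] vertices removes a colour and leaves a path with at
    least [(n - 1) / 2] vertices, so there are logarithmically many colours; a
    cycle is treated by deleting its lowest vertex. *)

Lemma set2_eq (T : finType) (a b x y : T) :
  [set a; b] = [set x; y] -> (a = x /\ b = y) \/ (a = y /\ b = x).
Proof.
move=> /setP E; move: (E a) (E b) (E x) (E y); rewrite !inE !eqxx !orbT /=.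
move=> /esym/orP[]/eqP -> /esym/orP[]/eqP ->; rewrite ?eqxx ?orbT ?orbb //=.
- by move=> _ /eqP ->; left.
- by left.
- by right.
- by move=> /eqP ->; left.
Qed.

(** * Families of disjoint paths as shallow topological minors *)

Section Linkages.
Variables (T : finType) (e : rel T).

Implicit Types (t : T * T * seq T) (M : {set T}) (L : seq (T * T * seq T)).

(* [((u, v), p)] stands for the path from [u] to [v] with internal vertices
   [p]. *)
Definition ends t : {set T} := [set t.1.1; t.1.2].

Definition link k M t :=
  [&& t.1.1 \in M, t.1.2 \in M, t.1.1 != t.1.2,
      path e t.1.1 (rcons t.2 t.1.2), uniq t.2, size t.2 <= k
    & all [predC M] t.2].

(** Ends are compared as unordered pairs: a second path between the same two vertices is excluded in
    either direction, so the paths of a linkage correspond to the edges of a simple graph. *)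
Definition apart t t' := (ends t != ends t') && ~~ has (mem t.2) t'.2.

Definition linkage k M L := all (link k M) L && pairwise apart L.

Lemma apart_sym : symmetric apart.
Proof. by move=> t t'; rewrite /apart eq_sym has_sym. Qed.

Lemma linkage_apart k M L t t' :
  linkage k M L -> t \in L -> t' \in L -> ends t != ends t' -> apart t t'.
Proof.
case/andP=> _; elim: L => //= a L IH /andP[/allP aL /IH {}IH].
rewrite !inE => /predU1P[->|tL] /predU1P[->|t'L] neq //; last 1 first.
- exact: IH.
- by rewrite eqxx in neq.
- exact: aL.
- by rewrite apart_sym; apply: aL.
Qed.

Lemma linkage_uniq_ends k M L : linkage k M L -> uniq (map ends L).
Proof.
case/andP=> _; rewrite uniq_pairwise pairwise_map; apply: sub_pairwise.
by move=> t t' /andP[].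
Qed.

Lemma linkage_minor d M L :
  symmetric e -> linkage (2 * d) M L ->
  exists (H : finType) (h : rel H),
    [/\ simple_graph h, shallow_top_minor h e d, #|H| = #|M|
      & size L <= #|edge_set h|].
Proof.
move=> e_sym linkL; have uL := linkage_uniq_ends linkL.
have /andP[/allP allL _] := linkL.
pose H : finType := {x : T | x \in M}.
pose h (x y : H) := [set val x; val y] \in map ends L.
have hP x y : h x y -> exists2 t, t \in L & ends t = [set val x; val y].
  by case/mapP=> t tL ->; exists t.
have hirr x : h x x = false.
  apply/negP=> /hP[t /allL/and3P[_ _ /andP[/eqP neq _]] /setP eqt].
  apply: neq; move: (eqt t.1.1) (eqt t.1.2); rewrite !inE !eqxx orbT !orbb /=.
  by move/esym/eqP=> -> /esym/eqP ->.
pose pick_t (x y : H) := nth ((val x, val y), [::]) L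
  (index [set val x; val y] (map ends L)).
have pickP x y : h x y -> pick_t x y \in L /\ ends (pick_t x y) = [set val x; val y].
  move=> hxy; have lt_i : index [set val x; val y] (map ends L) < size L.
    by rewrite -(size_map ends) index_mem.
  split; first exact: mem_nth.
  by rewrite -(nth_map _ set0) // nth_index.
(* Each path is stored in one direction only and is reversed when the edge is read from its other
   end; symmetry of [e] keeps it a path. *)
pose p (x y : H) := let t := pick_t x y in
  if t.1.1 == val x then t.2 else rev t.2.
have mem_p x y : p x y =i (pick_t x y).2.
  by move=> z; rewrite /p; case: ifP => // _; rewrite mem_rev.
exists H, h; split.
- split=> [x y|x]; last exact: hirr.
  by rewrite /h setUC.
- exists val, p; split; first exact: val_inj.
  + move=> u v huv; have [tL eqt] := pickP _ _ huv.
    have := allL _ tL; set t := pick_t u v in tL eqt *.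
    case/and3P=> t1M t2M /and5P[neq pt ut st /allP tM].
    have neuv : val u != val v.
      by apply/eqP=> /val_inj euv; rewrite euv hirr in huv.
    split.
    * rewrite /p -/t; case: (set2_eq eqt) => -[E1 E2].
        by rewrite E1 eqxx -E1 -E2.
      rewrite E1 eq_sym (negbTE neuv) -E1 -E2.
      have := rev_path e t.1.1 (rcons t.2 t.1.2).
      rewrite last_rcons belast_rcons rev_cons => ->.
      by rewrite (eq_path (e' := e)).
    * by rewrite /p; case: ifP; rewrite ?rev_uniq.
    * by rewrite /p; case: ifP; rewrite ?size_rev.
    * move=> z w; rewrite mem_p -/t => /tM /= zM.
      by apply: contraNneq zM => ->; apply: valP.
  + move=> u v u' v' huv hu'v' neq z; rewrite !mem_p.
    have [tL eqt] := pickP _ _ huv; have [t'L eqt'] := pickP _ _ hu'v'.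
    have /(linkage_apart linkL tL t'L) /andP[_ /hasPn disj] : 
       ends (pick_t u v) != ends (pick_t u' v').
      rewrite eqt eqt'; apply: contra neq => /eqP /setP E.
      by apply/eqP/setP=> x; have := E (val x); rewrite !inE !val_eqE.
    by move=> zt; apply/negP=> /disj /negP; apply.
- by rewrite card_sig; apply: eq_card => x; rewrite inE.
(* Distinct end sets pull back to distinct edges of [H], since each is recovered as an image under
   [val]. *)
- pose f t := [set x : H | val x \in ends t].
  have endsM t : t \in L -> ends t = val @: f t.
    move=> tL; have /and3P[t1M t2M _] := allL _ tL.
    apply/setP=> z; apply/idP/imsetP => [|[x]]; last by rewrite inE => ? ->.
    move=> zt; have zM : z \in M by case/set2P: zt => ->.
    by exists (exist _ z zM) => //; rewrite in_set.
  have uf : uniq (map f L).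
    apply: (@map_uniq _ _ (fun A : {set H} => val @: A)).
    rewrite -map_comp; suff -> : map (fun t => val @: f t) L = map ends L by [].
    by apply/eq_in_map => t /endsM/esym.
  rewrite -(size_map f) cardE; apply: uniq_leq_size => // A /mapP[t tL ->].
  have /and3P[t1M t2M _] := allL _ tL.
  rewrite mem_enum inE; apply/existsP; exists (Sub t.1.1 t1M).
  apply/existsP; exists (Sub t.1.2 t2M).
  apply/andP; split; first exact: (map_f ends tL).
  by apply/eqP/setP=> z; rewrite !inE -!val_eqE.
Qed.
End Linkages.

(** * Maximal families and independent sets *)

Lemma exists_maximal_seq (A : Type) (P : seq A -> Prop) n :
  P [::] -> (forall s, P s -> size s <= n) ->
  exists2 s, P s & forall a, ~ P (a :: s).
Proof.
move=> P0 bound; suff ext m s : P s -> n - size s <= m ->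
    exists2 s, P s & forall a, ~ P (a :: s) by exact: ext P0 (leqnn _).
elim: m s => [|m IH] s Ps le_m.
  by exists s => // a /bound /=; lia.
have [[a Pas]|noext] := classic (exists a, P (a :: s)).
  by apply: IH Pas _; rewrite /=; lia.
by exists s => // a Pas; apply: noext; exists a.
Qed.

(** The pairs are ordered, so every induced subgraph has average degree at most [2 * D]. A vertex of
    at most this degree is put into [I] and deleted with its neighbours, at a cost of at most
    [2 * D + 1] vertices. *)
Lemma sparse_independent_set (T : finType) (a : rel T) D :
  symmetric a -> irreflexive a ->
  (forall S : {set T},
     #|[set u : T * T | [&& u.1 \in S, u.2 \in S & a u.1 u.2]]|
       <= 2 * D * #|S|) ->
  forall S : {set T}, exists I : {set T},
    [/\ I \subset S, {in I &, forall u v, ~~ a u v}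
      & #|S| <= (2 * D).+1 * #|I|].
Proof.
move=> asym airr sparse S; have [n] := ubnP #|S|.
elim: n S => // n IH S ltSn; have [->|[x0 x0S]] := set_0Vmem S.
  by exists set0; split; rewrite ?cards0 // => u v; rewrite inE.
pose N u := [set v in S | a u v].
have [u uS leN] : exists2 u, u \in S & #|N u| <= 2 * D.
  apply/exists_inP; apply: contraT => /exists_inPn big.
  have := sparse S; rewrite leqNgt => /negP[].
  have -> : #|[set u : T * T | [&& u.1 \in S, u.2 \in S & a u.1 u.2]]|
          = \sum_(u in S) #|N u|.
    rewrite -sum1_card (eq_bigl (fun p : T * T =>
       (p.1 \in S) && (p.2 \in N p.1))); last by move=> p; rewrite !inE.
    rewrite -(pair_big_dep (mem S) (fun u v => v \in N u) (fun _ _ => 1)) /=.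
    by apply: eq_bigr => u _; rewrite sum1_card.
  have : \sum_(u in S) (2 * D).+1 <= \sum_(u in S) #|N u|.
    by apply: leq_sum => u /big; rewrite -ltnNge.
  have : 0 < #|S| by apply/card_gt0P; exists x0.
  rewrite sum_nat_const; nia.
pose S' := S :\: (u |: N u).
have leS : #|S| <= (2 * D).+1 + #|S'|.
  rewrite -(cardsID (u |: N u) S) leq_add2r.
  by rewrite (leq_trans (subset_leq_card (subsetIr _ _))) // cardsU1; lia.
have ltS' : #|S'| < n.
  apply: (@leq_trans #|S|) ltSn; apply: proper_card; apply/properP; split.
    exact: subsetDl.
  by exists u; rewrite // !inE eqxx.
have [I [sIS' indI leI]] := IH S' ltS'.
have uI : u \notin I by apply/negP=> /(subsetP sIS'); rewrite !inE eqxx.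
have auI v : v \in I -> ~~ a u v.
  by move=> /(subsetP sIS'); rewrite !inE negb_or negb_and -!andbA => /and3P[_ /orP[/negP ?|]].
exists (u |: I); split.
- by rewrite subUset sub1set uS (subset_trans sIS') // subsetDl.
- move=> v w /setU1P[->|vI] /setU1P[->|wI]; rewrite ?airr ?auI //.
    by rewrite asym auI.
  exact: indI.
- by rewrite cardsU1 uI mulnDr; lia.
Qed.

(** * Small sets blocking all short paths *)

Section Hitting.
Variables (T : finType) (e : rel T) (k D : nat).
Hypothesis e_sym : symmetric e.
Hypothesis k_gt0 : 0 < k.
Hypothesis sparse : forall M L, linkage e (2 * k) M L -> size L <= D * #|M|.

(** [q] lists the vertices after [w], so a path may be blocked at its very end in [S], but never at
    [w]. *)
Definition blocks (S X : {set T}) w :=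
  w \notin X /\ forall q, path e w q -> uniq (w :: q) -> q != [::] ->
    size q <= k -> last w q \in S -> has (mem X) q.

(* [(v, p)] stands for the path from [w] to [v] with internal vertices [p]. *)
Definition fan (M : {set T}) w (F : seq (T * seq T)) :=
  all (fun f => [&& path e w (rcons f.2 f.1), uniq (w :: rcons f.2 f.1),
                  size f.2 < k, f.1 \in M & all [predC M] f.2]) F
  && pairwise (fun f g => ~~ has (mem (rcons f.2 f.1)) (rcons g.2 g.1)) F.

(** As long as there are fewer than [l] paths, their vertices are too few to block [w], so some
    further path to [S] avoids them all. *)
Lemma exists_fan (S M : {set T}) w l :
  S \subset M ->
  (forall X : {set T}, #|X| <= l * k -> ~ blocks S X w) ->
  exists2 F, fan M w F & size F = l.
Proof.
move=> sSM unblocked.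
suff ext i : i <= l -> exists2 F, fan M w F & size F = i by exact: ext.
elim: i => [|i IH] lt_il; first by exists [::].
have [F /andP[fanF disjF] szF] := IH (ltnW lt_il).
pose V := flatten [seq rcons f.2 f.1 | f <- F].
have szV : size V <= i * k.
  rewrite -szF /V; elim: (F) fanF => //= f F' IHF /andP[/and3P[_ _ /andP[szf _]]].
  by move/IHF; rewrite size_cat size_rcons; lia.
have wV : w \notin V.
  apply/flattenP=> -[_ /mapP[f /(allP fanF) /and3P[_ /andP[wf _] _] ->]].
  by rewrite (negbTE wf).
have [q [pq uq q0 szq [qS qV]]] : exists q, [/\ path e w q, uniq (w :: q),
    q != [::], size q <= k & last w q \in S /\ ~~ has (mem [set x in V]) q].
  apply: NNPP => noq; apply: (unblocked [set x in V]).
    rewrite cardsE (leq_trans (card_size _)) // (leq_trans szV) //.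
    by rewrite leq_mul2r (ltnW lt_il) orbT.
  split=> [|q pq uq q0 szq qS]; first by rewrite inE.
  by apply: contraT => qV; case: noq; exists q; split.
have hasM : has (mem M) q.
  apply/hasP; exists (last w q); last exact: (subsetP sSM).
  by case: (q) q0 => //= a s _; apply: mem_last.
(* Cutting at the first vertex in [M] keeps the internal vertices outside [M]. *)
case/split_find: hasM pq uq szq qV => v p rest vM pM.
rewrite cat_path => /andP[pq _]; rewrite -cat_cons cat_uniq => /andP[uq _].
rewrite size_cat size_rcons has_cat negb_or => szq /andP[qV _].
exists ((v, p) :: F); last by rewrite /= szF.
apply/andP; split.
  rewrite [all _ _]/= fanF andbT; apply/and5P; split=> //.
    by move: szq; rewrite addSn; apply: leq_trans; rewrite ltnS leq_addr.
  by rewrite all_predC.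
rewrite [pairwise _ _]/= disjF andbT.
apply/allP=> f fF; apply: contra qV => /hasP[x xf xp]; apply/hasP.
exists x => //; rewrite /= in_set; apply/flattenP.
by exists (rcons f.2 f.1) => //; apply: (map_f (fun f => rcons f.2 f.1) fF).
Qed.

(** The number [l] is one more than the product of three factors: [D] from the sparsity of linkages
    on [M], [1 + 2 * k * D] from comparing [M] with [S], and [2 * D + 1] from comparing [S] with
    [I]. *)
Lemma sparse_blocked (S : {set T}) : S != set0 ->
  let l := (D * (1 + 2 * k * D) * (2 * D).+1).+1 in
  exists w (X : {set T}), [/\ w \in S, #|X| <= l * k & blocks S X w].
Proof.
move=> S0 l; apply: NNPP => unblocked.
have {}unblocked w : w \in S -> forall X : {set T}, #|X| <= l * k -> ~ blocks S X w.
  by move=> wS X leX bX; apply: unblocked; exists w, X.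
have [L linkL maxL] : exists2 L, linkage e (2 * k) S L &
    forall t, ~ linkage e (2 * k) S (t :: L).
  exact: exists_maximal_seq (fun L => @sparse S L).
have /andP[/allP allL pwL] := linkL.
pose V := flatten [seq t.2 | t <- L].
pose M := S :|: [set x in V].
have sSM : S \subset M by apply: subsetUl.
have cardM : #|M| <= (1 + 2 * k * D) * #|S|.
  have : size V <= 2 * k * size L.
    rewrite /V; elim: (L) allL => //= t L' IHL allL'.
    have /and3P[_ _ /and5P[_ _ _ szt _]] := allL' t (mem_head _ _).
    have := IHL (fun t' t'L => allL' t' (@mem_behead _ (t :: L') _ t'L)).
    by rewrite size_cat mulnS; move: szt; clear; lia.
  have cardV : #|[set x in V]| <= size V by rewrite cardsE card_size.
  move=> szV; apply: leq_trans (leq_card_setU _ _) _.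
  rewrite mulnDl mul1n leq_add2l (leq_trans cardV) // (leq_trans szV) //.
  by rewrite -[2 * k * D * _]mulnA leq_mul2l (sparse linkL) orbT.
pose adj u v := [set u; v] \in map (@ends T) L.
have adj_sym : symmetric adj by move=> u v; rewrite /adj setUC.
have adj_irr : irreflexive adj.
  move=> u; apply/negP=> /mapP[t /allL/and3P[_ _ /andP[/eqP neq _]] eqt].
  by case: (set2_eq eqt) neq => -[<- <-].
have [I [sIS indI leS]] : exists I : {set T},
    [/\ I \subset S, {in I &, forall u v, ~~ adj u v}
      & #|S| <= (2 * D).+1 * #|I|].
  apply: sparse_independent_set => // S'.
  (* The paths of [L] with both ends in [S'] form a linkage on [S :&: S']; [Q] counts each of them
     in both orientations. *)
  pose L' := [seq t <- L | (t.1.1 \in S') && (t.1.2 \in S')].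
  have : linkage e (2 * k) (S :&: S') L'.
    apply/andP; split; last exact: pairwise_filter.
    apply/allP=> t; rewrite mem_filter => /andP[/andP[t1 t2] /allL].
    case/and3P=> t1S t2S /and5P[neq pt ut szt /allP tS].
    rewrite /link !inE t1 t1S t2 t2S neq pt ut szt /=.
    by apply/allP=> z /tS /=; rewrite inE; case: (z \in S).
  move/sparse => szL'.
  pose Q := [seq t.1 | t <- L'] ++ [seq (t.1.2, t.1.1) | t <- L'].
  apply: (@leq_trans (size Q)); last first.
    rewrite size_cat !size_map.
    have := subset_leq_card (subsetIr S S'); move: szL'; clear; nia.
  apply: leq_trans (card_size Q); apply: subset_leq_card.
  apply/subsetP=> -[u v]; rewrite !inE /= => /and3P[uS vS /mapP[t tL /set2_eq]].
  rewrite mem_cat; case=> -[E1 E2]; subst u v; apply/orP; [left|right]; apply/mapP;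
    exists t; rewrite ?mem_filter ?uS ?vS ?tL //.
  by case: (t.1).
(* Once shortened to a simple path, [q] could be added to [L]: it avoids [S] and all internal
   vertices of [L], and [w] and [w'] are not yet joined. Admitting walks here allows pieces of two
   fan paths to be concatenated freely. *)
have noconn w w' q : w \in I -> w' \in I -> w != w' -> path e w q ->
    last w q = w' -> size q <= 2 * k -> {in q, forall z, z \in M -> z = w'} ->
    False.
  move=> wI w'I neq pq lq szq qM.
  have wS := subsetP sIS _ wI; have w'S := subsetP sIS _ w'I.
  case/shortenP: pq lq => q' pq' uq' sub lq'.
  have szq' : size q' <= size q.
    by apply: uniq_leq_size; [case/andP: uq' |].
  case/lastP: q' pq' uq' sub lq' szq' => [|p v] pq' uq' sub.
    by move/eqP; rewrite (negbTE neq).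
  rewrite last_rcons size_rcons => Ev szp; subst v.
  have pM : all [predC M] p.
    apply/allP=> z zp /=; have zq : z \in q.
      by apply: sub; rewrite mem_rcons inE zp orbT.
    apply/negP=> /(qM z zq) Ez.
    by move: uq'; rewrite /= rcons_uniq -Ez zp andbF.
  apply: (maxL ((w, w'), p)); apply/andP; split; apply/andP; split=> //.
  - apply/and3P; split=> //; apply/and5P; split=> //.
    + by move: uq'; rewrite /= rcons_uniq => /and3P[].
    + by apply: leq_trans szq; apply: ltnW.
    + apply/allP=> z /(allP pM) /=; apply: contra; exact: (subsetP sSM).
  - exact/allP.
  - apply/allP=> t tL; apply/andP; split.
      by apply: contra (indI _ _ wI w'I) => /eqP E; apply/mapP; exists t.
    apply/hasPn=> z zt; apply/negP=> /(allP pM) /= /negP[].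
    by rewrite !inE; apply/orP; right; apply/flattenP; exists t.2; rewrite ?map_f.
have /fin_all_exists[F FP] : forall w, exists F, w \in I -> fan M w F /\ size F = l.
  move=> w; have [wI|] := boolP (w \in I); last by exists [::].
  have [F fanF szF] := exists_fan sSM (unblocked w (subsetP sIS _ wI)).
  by exists F.
pose fanL w := [seq ((w, f.1), f.2) | f <- F w].
have fanLP w t : w \in I -> t \in fanL w -> [/\ t.1.1 = w, path e w (rcons t.2 t.1.2),
    uniq (w :: rcons t.2 t.1.2), size t.2 < k & (t.1.2 \in M) /\ all [predC M] t.2].
  move=> wI /mapP[f fF ->]; have [/andP[/allP/(_ _ fF)/and5P[? ? ? ? ?] _] _] := FP w wI.
  by split.
pose L2 := flatten [seq fanL w | w <- enum I].
have : linkage e (2 * k) M L2.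
  apply/andP; split.
    apply/allP=> t /flatten_mapP[w]; rewrite mem_enum => wI.
    case/(fanLP _ _ wI)=> t1 pt ut szt [t2M tM]; rewrite /link t1 pt t2M tM.
    rewrite (subsetP sSM) ?(subsetP sIS) //=.
    move: ut; rewrite /= rcons_uniq mem_rcons inE negb_or => /and3P[/andP[-> _] _ ->] /=.
    by rewrite andbT (leq_trans (ltnW szt)) // leq_pmull.
  rewrite /L2; have := enum_uniq I; have : {subset enum I <= I} by move=> w; rewrite mem_enum.
  elim: (enum I) => //= w s IHs sub /andP[ws us].
  rewrite pairwise_cat IHs ?andbT //; last by move=> x xs; apply: sub; rewrite inE xs orbT.
  have wI := sub w (mem_head _ _).
  apply/andP; split; last first.
    have [/andP[_ pw] _] := FP w wI; rewrite /fanL pairwise_map.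
    apply: sub_pairwise pw => f g fg; apply/andP; split => /=.
      apply: contra fg => /eqP /set2_eq E; apply/hasP; exists f.1.
        by rewrite mem_rcons inE; case: E => /= -[E1 E2]; rewrite E2 ?E1 eqxx.
      by rewrite /= mem_rcons mem_head.
    apply: contra fg => /hasP[z zg zf]; apply/hasP; exists z.
      by rewrite mem_rcons inE zg orbT.
    by rewrite /= mem_rcons inE (zf : z \in f.2) orbT.
  apply/allrelP=> t t' tw /flatten_mapP[w' w's t'w'].
  have w'I : w' \in I by apply: sub; rewrite inE w's orbT.
  have neq : w != w' by apply: contraNneq ws => ->.
  have [t1 pt ut szt [t2M tM]] := fanLP _ _ wI tw.
  have [t'1 pt' ut' szt' [t'2M t'M]] := fanLP _ _ w'I t'w'.
  apply/andP; split.
    (* If the ends agree, the fan path from [w] ends at [w'], which [noconn] forbids. *)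
    apply/negP=> /eqP /set2_eq; rewrite t1 t'1 => -[[/eqP]|[_ E]].
      by rewrite (negbTE neq).
    apply: (noconn w w' _ wI w'I neq pt); first by rewrite last_rcons.
      by rewrite size_rcons (leq_trans szt) // leq_pmull.
    move=> z; rewrite mem_rcons inE => /predU1P[->//|/(allP tM) /=].
    by move=> /negbTE->.
  (* If two fans meet at [z] outside [M], following one path to [z] and the other back to [w'] gives
     a walk of length at most [2 * k]. *)
  apply/negP=> /hasP[z zt' zt].
  have zM : z \notin M by exact: (allP tM).
  case/splitPr: zt pt szt tM => a b; rewrite rcons_cat cat_path /=.
  move=> /and3P[pa az _] szt /allP tM.
  case/splitPr: zt' pt' szt' t'M => a' b'; rewrite rcons_cat cat_path /=.
  move=> /and3P[pa' az' _] szt' /allP t'M.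
  apply: (noconn w w' (a ++ z :: rcons (rev a') w') wI w'I neq).
  - rewrite cat_path pa /= az /=.
    have := rev_path e w' (rcons a' z).
    rewrite last_rcons belast_rcons rev_cons => ->.
    by rewrite (eq_path (e' := e)) ?rcons_path ?pa'.
  - by rewrite last_cat /= last_rcons.
  - move: szt szt'; rewrite !size_cat /= size_rcons size_rev; clear; lia.
  - move=> x; rewrite mem_cat inE mem_rcons inE mem_rev => /or4P[xa|/eqP->|/eqP->//|xa'].
    + by have /negbTE-> := tM x ltac:(by rewrite mem_cat xa).
    + by rewrite (negbTE zM).
    + by have /negbTE-> := t'M x ltac:(by rewrite mem_cat xa').
move/sparse.
have -> : size L2 = #|I| * l.
  rewrite size_flatten /shape -map_comp sumnE big_map big_enum /=.
  rewrite -sum_nat_const; apply: eq_bigr => w wI.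
  by rewrite size_map; case: (FP w wI).
have : 0 < #|S| by rewrite card_gt0.
(* The fans provide [#|I| * l] paths, while sparsity allows at most [#|I| * (l - 1)]. *)
rewrite /l; move: cardM leS; move: #|S| #|I| #|M| => nS nI nM; clear.
move: (1 + 2 * k * D) ((2 * D).+1) => c1 c2 leM leS S_gt0.
have I_gt0 : 0 < nI by move: S_gt0 leS; case: nI => //; rewrite muln0; lia.
have : D * nM <= D * (c1 * (c2 * nI)).
  by rewrite leq_mul2l (leq_trans leM) ?leq_mul2l ?leS ?orbT.
have -> : D * (c1 * (c2 * nI)) = nI * (D * c1 * c2) by lia.
rewrite mulnS; lia.
Qed.

End Hitting.

(** * Elimination orders and greedy colouring *)

Lemma elimination_order (T : finType) (P : {set T} -> T -> Prop) :
  (forall S, S != set0 -> exists2 w, w \in S & P S w) ->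
  exists2 rank : T -> nat,
    injective rank & forall w, P [set u | rank u <= rank w] w.
Proof.
move=> elimP.
suff [rank [inj _ rankP]] : exists rank : T -> nat,
    [/\ {in [set: T] &, injective rank}, {in [set: T], forall u, rank u < #|[set: T]|}
      & {in [set: T], forall w, P [set u in [set: T] | rank u <= rank w] w}].
  exists rank => [u v|w]; first by apply: inj; rewrite inE.
  by have := rankP w (in_setT _); congr P; apply/setP=> u; rewrite !inE.
move: [set: T] => S; have [n] := ubnP #|S|.
elim: n S => // n IH S ltSn; have [->|[x0 x0S]] := set_0Vmem S.
  by exists (fun=> 0); split=> ?; rewrite inE.
have [w wS PSw] : exists2 w, w \in S & P S w.
  by apply: elimP; apply/set0Pn; exists x0.
have cardS : #|S| = #|S :\ w|.+1 by rewrite (cardsD1 w S) wS.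
have [|rank [inj lt_rank rankP]] := IH (S :\ w); first by rewrite -ltnS -cardS.
(* The vertex removed first gets the largest rank, so the vertices ranked no higher than a given one
   are those still present when it is removed. *)
pose rank' u := if u == w then #|S :\ w| else rank u.
have rank'w : rank' w = #|S :\ w| by rewrite /rank' eqxx.
have rank'E u : u \in S -> u != w -> (rank' u = rank u) /\ (rank u < #|S :\ w|).
  by move=> uS uw; rewrite /rank' (negbTE uw) lt_rank // !inE uw.
exists rank'; split.
- move=> u v uS vS; have [->|uw] := eqVneq u w; have [->|vw] := eqVneq v w => //.
  + by rewrite rank'w; have [-> lt] := rank'E _ vS vw => E; rewrite -E ltnn in lt.
  + by rewrite rank'w; have [-> lt] := rank'E _ uS uw => E; rewrite E ltnn in lt.
  + have [-> _] := rank'E _ uS uw; have [-> _] := rank'E _ vS vw.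
    by apply: inj; rewrite !inE ?uw ?vw.
- move=> u uS; rewrite cardS ltnS; have [->|uw] := eqVneq u w; first by rewrite rank'w.
  by have [-> /ltnW] := rank'E _ uS uw.
- move=> u uS; have [->|uw] := eqVneq u w.
    rewrite rank'w; move: PSw; congr P; apply/setP=> x; rewrite !inE.
    have [xS|//] := boolP (x \in S); have [->|xw] := eqVneq x w.
      by rewrite rank'w leqnn.
    by have [-> /ltnW ->] := rank'E _ xS xw.
  have [-> lt] := rank'E _ uS uw.
  have uS' : u \in S :\ w by rewrite !inE uw.
  move: (rankP u uS'); congr P; apply/setP=> x; rewrite !inE.
  have [->|xw] /= := eqVneq x w; first by rewrite rank'w leqNgt lt andbF.
  by have [xS|//] := boolP (x \in S); have [-> _] := rank'E _ xS xw.
Qed.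

Lemma greedy_colouring (T : finType) (rank : T -> nat) (W : T -> {set T}) m :
  injective rank -> (forall v, #|W v| <= m) ->
  exists c : T -> nat, (forall v, c v <= m) /\
    forall u v, u \in W v -> rank u < rank v -> c u != c v.
Proof.
move=> inj leW.
suff [c [cm cP]] : exists c : T -> nat, (forall v, c v <= m) /\
    forall u v, u \in W v -> rank u < rank v < (\max_v rank v).+1 -> c u != c v.
  exists c; split=> // u v uv lt; apply: cP => //.
  by rewrite lt ltnS (leq_bigmax v).
(* Vertices are coloured by increasing rank. By injectivity at most one vertex [v] has rank [n], and
   [W v] uses up at most [m] of the [m + 1] colours. *)
elim: (_.+1) => [|n [c [cm cP]]]; first by exists (fun=> 0); split=> // u v _; rewrite andbF.
have [v /eqP rkv|norank] := pickP (fun v => rank v == n); last first.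
  exists c; split=> // u v uv /andP[lt1]; rewrite ltnS leq_eqVlt norank /= => lt2.
  by apply: cP; rewrite // lt1.
have [j jm jW] : exists2 j, j <= m & j \notin [seq c u | u in W v].
  have [/allP sub|/allPn[j]] := boolP (all (mem [seq c u | u in W v]) (iota 0 m.+1)).
    have := uniq_leq_size (iota_uniq _ _) sub.
    by rewrite size_iota size_map -cardE ltnNge leW.
  by rewrite mem_iota; exists j.
exists (fun u => if u == v then j else c u); split=> [u|u u'].
  by case: ifP.
move=> uW /andP[lt1]; rewrite ltnS leq_eqVlt -rkv (inj_eq inj) => /orP[/eqP Eu'|lt2].
  subst u'; rewrite eqxx; case: (u =P v) => [Eu|_]; first by rewrite Eu ltnn in lt1.
  by apply: contraNneq jW => <-; apply/imageP; exists u.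
have -> : (u' == v) = false by apply/eqP=> E; rewrite E ltnn in lt2.
have -> : (u == v) = false.
  by apply/eqP=> E; have := ltn_trans lt1 lt2; rewrite E ltnn.
by apply: cP; rewrite // lt1 -rkv.
Qed.

(** * Weak reachability through blocking sets *)

Section WeakReachability.
Variables (T : finType) (e : rel T) (k N : nat).
Variables (rank : T -> nat) (X : T -> {set T}).
Hypothesis cardX : forall v, #|X v| <= N.
Hypothesis blockX : forall v, blocks e k [set u | rank u <= rank v] (X v) v.

(** Keeping [v] at every level allows fewer than [i] steps. By [path_reach], [reach k v] contains
    the vertices weakly [k]-reachable from [v]. *)
Fixpoint reach i v : {set T} :=
  v |: (if i is j.+1 then \bigcup_(x in X v) reach j x else set0).

Lemma card_reach i v : #|reach i v| <= N.+1 ^ i.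
Proof.
elim: i v => [|i IH] v /=; first by rewrite setU0 cards1.
apply: leq_trans (leq_card_setU _ _) _; rewrite cards1.
have : #|\bigcup_(x in X v) reach i x| <= #|X v| * N.+1 ^ i.
  rewrite -sum_nat_const; elim/big_ind2: _ => // [|A a B b leA leB].
    by rewrite cards0.
  by apply: leq_trans (leq_card_setU _ _) (leq_add leA leB).
move=> le1; have le2 : #|X v| * N.+1 ^ i <= N * N.+1 ^ i by rewrite leq_mul2r cardX orbT.
by rewrite expnS mulSn leq_add ?expn_gt0 // (leq_trans le1).
Qed.

(** The end is ranked no higher than [v], so [X v] meets the path at some [x]; the part after [x] is
    shorter and still ends in its lowest vertex. *)
Lemma path_reach i v q :
  i <= k -> path e v q -> uniq (v :: q) -> size q <= i ->
  {in v :: q, forall x, rank (last v q) <= rank x} -> last v q \in reach i v.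
Proof.
elim: i v q => [|i IH] v q le_ik pq uq szq minq.
  by case: q szq {pq uq minq} => //= _; rewrite setU0 inE.
have [->|q0] := eqVneq q [::]; first by rewrite /= !inE eqxx.
have [_ /(_ q pq uq q0 (leq_trans szq le_ik))] := blockX v.
rewrite inE minq ?mem_head // => /(_ isT) /hasP[x xq xX].
case/splitPr: xq pq uq szq minq {q0} => a b.
rewrite cat_path last_cat /= => /and3P[_ _ pb] uq szq minq.
rewrite !inE; apply/orP; right; apply/bigcupP; exists x => //.
apply: IH => //; first exact: ltnW.
- by move: uq => /andP[_]; rewrite cat_uniq => /and3P[].
- by move: szq; rewrite size_cat /=; lia.
- by move=> y yb; apply: minq; rewrite -cat_cons mem_cat yb orbT.
Qed.

End WeakReachability.

(** The greedy colouring is applied with [reach k v] as the set of vertices whose colours [v] must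
    avoid. *)
Lemma sparse_colouring (T : finType) (e : rel T) (k D : nat) :
  symmetric e -> 0 < k ->
  (forall M L, linkage e (2 * k) M L -> size L <= D * #|M|) ->
  exists (rank c : T -> nat),
  [/\ injective rank,
      forall v, c v <= ((D * (1 + 2 * k * D) * (2 * D).+1).+1 * k).+1 ^ k
    & forall v q, path e v q -> uniq (v :: q) -> size q <= k -> q != [::] ->
        {in v :: q, forall x, rank (last v q) <= rank x} -> c (last v q) != c v].
Proof.
move=> e_sym k_gt0 sparse; set N := _.+1 * k.
have [|rank inj rankP] := @elimination_order T
    (fun S w => exists X : {set T}, #|X| <= N /\ blocks e k S X w).
  move=> S /(sparse_blocked e_sym k_gt0 sparse)[w [X [wS leX bX]]].
  by exists w => //; exists X.
have /fin_all_exists[X XP] := rankP.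
have cardX v : #|X v| <= N by have [] := XP v.
have blockX v : blocks e k [set u | rank u <= rank v] (X v) v by have [] := XP v.
have [c [cm cP]] := greedy_colouring inj (card_reach cardX k).
exists rank, c; split=> // v q pq uq szq q0 minq.
apply: cP; first exact: path_reach.
rewrite ltn_neqAle minq ?mem_head // andbT (inj_eq inj).
case/lastP: q q0 uq {pq szq minq} => // q x _; rewrite last_rcons /=.
by rewrite mem_rcons inE negb_or eq_sym => /andP[/andP[]].
Qed.

(** * The edge colouring and its colour counts *)

Section EdgeColouring.
Variables (T : finType) (e : rel T) (k : nat) (rank c : T -> nat).
Hypothesis e_sym : symmetric e.
Hypothesis rank_inj : injective rank.
Hypothesis c_sep : forall v q, path e v q -> uniq (v :: q) -> size q <= k ->
  q != [::] -> {in v :: q, forall x, rank (last v q) <= rank x} ->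
  c (last v q) != c v.

(** The default 0 occurs only for the empty set, which is not an edge. *)
Definition edge_colour (A : {set T}) : nat :=
  if [pick x in A | [forall y in A, rank x <= rank y]] is Some x then c x else 0.

Lemma edge_colour_min v x : rank v <= rank x -> edge_colour [set v; x] = c v.
Proof.
move=> le_vx; rewrite /edge_colour; case: pickP => [y|/(_ v)].
  case/andP=> /set2P[->//|->] /forall_inP/(_ v); rewrite set21 => /(_ isT) le_xv.
  by congr c; apply/rank_inj/eqP; rewrite eqn_leq le_xv.
rewrite set21 /= => /negP[]; apply/forall_inP=> y.
by case/set2P=> ->.
Qed.

Lemma edge_colourP x y : edge_colour [set x; y] \in [:: c x; c y].
Proof.
have [le|/ltnW le] := leqP (rank x) (rank y).
  by rewrite edge_colour_min // mem_head.
by rewrite setUC edge_colour_min // !inE eqxx orbT.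
Qed.

Definition path_colours (s : seq T) : seq nat :=
  if s is x :: p then pairmap (fun y z => edge_colour [set y; z]) x p else [::].

Definition n_path_colours s := size (undup (path_colours s)).

Lemma path_colours_catl s1 s2 :
  {subset path_colours s1 <= path_colours (s1 ++ s2)}.
Proof.
by case: s1 => //= x s1 y ys1; rewrite pairmap_cat mem_cat ys1.
Qed.

Lemma path_colours_catr s1 s2 :
  {subset path_colours s2 <= path_colours (s1 ++ s2)}.
Proof.
case: s1 => // x s1; case: s2 => //= y s2 z zs2.
by rewrite pairmap_cat mem_cat inE zs2 !orbT.
Qed.

Lemma path_coloursP s y : y \in path_colours s -> exists2 x, x \in s & y = c x.
Proof.
case: s => //= x s; elim: s x => //= z s IH x; rewrite inE => /predU1P[->|/IH].
  have := edge_colourP x z; rewrite !inE => /orP[]/eqP->.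
    by exists x; rewrite ?mem_head.
  by exists z; rewrite // !inE eqxx orbT.
by case=> w ws ->; exists w; rewrite // inE ws orbT.
Qed.

Lemma min_path_colour s1 v s2 :
  s1 ++ s2 != [::] -> {in s1 ++ v :: s2, forall x, rank v <= rank x} ->
  c v \in path_colours (s1 ++ v :: s2).
Proof.
case/lastP: s1 => [|s1 x] ne minv.
  case: s2 ne minv => //= y s2 _ minv.
  by rewrite edge_colour_min ?mem_head // minv // !inE eqxx orbT.
rewrite cat_rcons; apply: path_colours_catr => /=.
by rewrite setUC edge_colour_min ?mem_head // minv // cat_rcons mem_cat mem_head orbT.
Qed.

(** The segment between [x] and [v], read from [x], is a path of length at most [k] ending in its
    lowest vertex, so [c_sep] applies; if [v] comes first, the segment is reversed. *)
Lemma min_colour_unique s1 v s2 x :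
  sorted e (s1 ++ v :: s2) -> uniq (s1 ++ v :: s2) -> size (s1 ++ s2) <= k ->
  {in s1 ++ v :: s2, forall x, rank v <= rank x} ->
  x \in s1 ++ s2 -> c v != c x.
Proof.
move=> ps us szs minv.
rewrite mem_cat => /orP[]/splitPr xs; case: xs ps us szs minv => a b.
  rewrite -catA cat_cons => ps us szs minv.
  have {ps} pb : path e x (rcons b v).
    by have [_] := cat_sorted2 ps; rewrite /= -cat_rcons cat_path => /andP[].
  rewrite -(last_rcons x b v); apply: c_sep => //.
  - move: us; rewrite cat_uniq => /and3P[_ _]; rewrite -cat_rcons -cat_cons.
    by rewrite cat_uniq => /andP[].
  - by move: szs; rewrite !size_cat size_rcons /=; lia.
  - by case: (b).
  - move=> y yb; rewrite last_rcons; apply: minv.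
    by rewrite mem_cat -cat_rcons -cat_cons mem_cat yb orbT.
move=> ps us szs minv.
have {ps} pa : path e v (rcons a x).
  by have [_] := cat_sorted2 ps; rewrite /= -cat_rcons cat_path => /andP[].
have {}pa : path e x (rcons (rev a) v).
  have := rev_path e v (rcons a x).
  rewrite last_rcons belast_rcons rev_cons => ->.
  by rewrite (eq_path (e' := e)).
have memE : x :: rcons (rev a) v =i v :: rcons a x.
  by move=> y; rewrite !inE !mem_rcons !inE mem_rev orbCA.
rewrite -(last_rcons x (rev a) v); apply: c_sep => //.
- move: us; rewrite cat_uniq => /and3P[_ _]; rewrite -cat_rcons -cat_cons.
  rewrite cat_uniq => /andP[]; rewrite (perm_uniq (s2 := x :: rcons (rev a) v)) //.
  rewrite -!cats1 -[v :: a ++ _]cat1s -[x :: rev a ++ _]cat1s perm_catC -!catA.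
  by apply/permP=> P; rewrite !count_cat count_rev /=; lia.
- by move: szs; rewrite !size_cat size_rcons size_rev /=; lia.
- by case: (rev a).
- move=> y; rewrite last_rcons memE => ya; apply: minv.
  by rewrite mem_cat -cat_rcons -cat_cons mem_cat ya orbT.
Qed.

(** Every colour on [s] is the colour of one of its vertices, hence differs from [c v], while [c v]
    does occur on the whole path. *)
Lemma n_path_colours_min s1 v s2 s :
  sorted e (s1 ++ v :: s2) -> uniq (s1 ++ v :: s2) -> size (s1 ++ s2) <= k ->
  {in s1 ++ v :: s2, forall x, rank v <= rank x} -> s1 ++ s2 != [::] ->
  s \in [:: s1; s2] -> n_path_colours s < n_path_colours (s1 ++ v :: s2).
Proof.
move=> ps us szs minv ne; rewrite !inE => s12.
have [sub sub_c] : {subset s <= s1 ++ s2} /\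
    {subset path_colours s <= path_colours (s1 ++ v :: s2)}.
  case/orP: s12 => /eqP->; split.
  - by move=> x xs; rewrite mem_cat xs.
  - exact: path_colours_catl.
  - by move=> x xs; rewrite mem_cat xs orbT.
  - by rewrite -cat_rcons; apply: path_colours_catr.
rewrite -[_ < _]/(size (c v :: undup (path_colours s)) <= _).
apply: uniq_leq_size => [|y].
  rewrite /= undup_uniq andbT mem_undup; apply/negP=> /path_coloursP[x /sub xs].
  by apply/eqP; apply: min_colour_unique xs.
rewrite inE !mem_undup => /predU1P[->|/sub_c//].
exact: min_path_colour.
Qed.

Lemma exists_min_rank (s : seq T) : s != [::] ->
  exists2 v, v \in s & {in s, forall x, rank v <= rank x}.
Proof.
case: s => // x0 s _; have [v vs minv] := arg_minnP rank (mem_head x0 s).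
by exists v.
Qed.

(** If [n] colours occur, each of the two pieces left after deleting the lowest vertex has fewer
    than [2 ^ n] vertices; adding the deleted vertex still gives fewer than [2 ^ n.+1]. *)
Lemma size_path_colours s :
  sorted e s -> uniq s -> size s <= k.+1 -> size s < 2 ^ (n_path_colours s).+1.
Proof.
have [n] := ubnP (size s); elim: n s => // n IH s lt_sn ps us szs.
have [->|s0] := eqVneq s [::]; first by [].
have [v vs minv] := exists_min_rank s0.
case/splitPr: s / vs lt_sn ps us szs minv s0 => s1 s2 lt_sn ps us szs minv _.
have [E|ne] := eqVneq (s1 ++ s2) [::].
  by case: s1 s2 E {IH lt_sn ps us szs minv} => // -[].
have szs' : size (s1 ++ s2) <= k.
  by move: szs; rewrite !size_cat /= addnS.
have lt_s t : t \in [:: s1; s2] -> size t < 2 ^ n_path_colours (s1 ++ v :: s2).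
  move=> s12; have := n_path_colours_min ps us szs' minv ne s12.
  rewrite -(leq_exp2l (m := 2)) //; apply: leq_trans.
  have sz12 : size t <= size (s1 ++ s2).
    by move: s12; rewrite !inE size_cat => /orP[]/eqP->; lia.
  apply: IH.
  - by move: lt_sn; rewrite ltnS; apply: leq_trans; move: sz12; rewrite !size_cat /=; lia.
  - move: s12; rewrite !inE => /orP[]/eqP->.
      by have [] := cat_sorted2 ps.
    by have [_ /path_sorted] := cat_sorted2 ps.
  - move: us s12; rewrite cat_uniq /= !inE => /and3P[u1 _ /andP[_ u2]].
    by case/orP=> /eqP->.
  - by rewrite (leq_trans sz12) // leqW.
have := lt_s s1; have := lt_s s2; rewrite !inE !eqxx orbT => /(_ isT) lt2 /(_ isT) lt1.
by rewrite size_cat /= expnS mul2n -addnn -addSn leq_add.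
Qed.

Lemma path_colours_cycle v s y : uniq (v :: s) ->
  y \in path_colours (v :: s) ->
  y \in [seq edge_colour [set x; next (v :: s) x] | x <- v :: s].
Proof.
move=> us /(nthP 0)[i]; rewrite size_pairmap => lt_i <-.
rewrite (nth_pairmap v) //; apply/mapP; exists (nth v (v :: s) i).
  by rewrite mem_nth // ltnW.
have lt_i' : i < size (v :: s) by rewrite ltnW.
by rewrite next_nth mem_nth // index_uniq.
Qed.

Lemma edge_colour_cycle cy : 0 < k -> is_graph_cycle e cy ->
  (size cy <= 2 ^ cycle_colours edge_colour cy)
  \/ (k < 2 ^ cycle_colours edge_colour cy).
Proof.
move=> k_gt0 [cyc ucy szcy].
have [|v vcy minv] := @exists_min_rank cy; first by case: (cy) szcy.
have [i s rots] := rot_to vcy.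
have us : uniq (v :: s) by rewrite -rots rot_uniq.
have ps : path e v s.
  by move: cyc; rewrite -(rot_cycle i) rots /= rcons_path => /andP[].
have szs : size cy = (size s).+1 by rewrite -(size_rot i) rots.
(* Truncation leaves at most [k + 1] vertices in [v :: p], the range in which the colour of [v] is
   unique. *)
pose p := take k s.
have vpE : v :: s = (v :: p) ++ drop k s by rewrite /= cat_take_drop.
have pp : sorted e ([::] ++ v :: p).
  by move: ps; rewrite -[s](cat_take_drop k) /= cat_path => /andP[].
have up : uniq ([::] ++ v :: p) by move: us; rewrite vpE cat_uniq => /andP[].
have szp : size p <= k by rewrite size_take; case: ltnP.
have p0 : p != [::].
  rewrite -size_eq0 size_take; case: ltnP => _; first by rewrite -lt0n.
  by move: szs szcy; lia.
have minp : {in [::] ++ v :: p, forall x, rank v <= rank x}.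
  move=> x xp; apply: minv; rewrite -(mem_rot i) rots vpE mem_cat.
  by rewrite (xp : x \in v :: p).
have lt_p : n_path_colours p < n_path_colours (v :: p).
  by apply: (n_path_colours_min pp up szp minp p0); rewrite !inE eqxx orbT.
have le_cy : n_path_colours (v :: p) <= cycle_colours edge_colour cy.
  apply: uniq_leq_size; first exact: undup_uniq.
  move=> y; rewrite !mem_undup => /(path_colours_catl (drop k s)).
  rewrite -vpE => /(path_colours_cycle us); rewrite -rots map_rot mem_rot.
  rewrite (@eq_map _ _ _ (fun x => edge_colour [set x; next cy x])) //.
  by move=> x; rewrite next_rot.
have : size p < 2 ^ cycle_colours edge_colour cy.
  apply: leq_trans (_ : 2 ^ (n_path_colours p).+1 <= _).
    apply: size_path_colours; first exact: path_sorted pp.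
      by case/andP: up.
    exact: leqW.
  by rewrite leq_exp2l // (leq_trans lt_p).
(* Either [p] was truncated and has [k] vertices, or it is the whole cycle without [v], and the
   strict bound absorbs the missing vertex. *)
rewrite /p size_take szs; case: (ltnP k (size s)) => _ ?; [by right | by left].
Qed.

Lemma ncolours_edge_colour m : (forall v, c v <= m) -> ncolours e edge_colour <= m.+1.
Proof.
move=> cm; rewrite -(size_iota 0 m.+1); apply: uniq_leq_size; first exact: undup_uniq.
move=> y; rewrite mem_undup => /mapP[A _ ->]; rewrite mem_iota /= add0n ltnS.
by rewrite /edge_colour; case: pickP.
Qed.

End EdgeColouring.

(** * Admissibility and the polynomial bound *)

Lemma edge_colour_admissible (T : finType) (e : rel T) r (rank c : T -> nat) :
  symmetric e -> injective rank ->
  (forall v q, path e v q -> uniq (v :: q) -> size q <= 2 ^ r -> q != [::] ->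
     {in v :: q, forall x, rank (last v q) <= rank x} -> c (last v q) != c v) ->
  admissible_colouring e f0 r (edge_colour rank c).
Proof.
move=> e_sym inj sep cy cyP; rewrite geq_min.
have [le|] := edge_colour_cycle e_sym inj sep (expn_gt0 _ _) cyP.
  by rewrite up_log_min.
by rewrite ltn_exp2l // => ->; rewrite orbT.
Qed.

Theorem mainTheorem5 :
  forall r : nat, 0 < r ->
  exists P : {poly rat},
    forall (T : finType) (e : rel T), simple_graph e ->
    forall x : rat, is_top_grad e (2 ^ r) x ->
    exists col : {set T} -> nat,
      admissible_colouring e f0 r col /\ ((ncolours e col)%:R <= P.[x])%R.
Proof.
move=> r _; pose k := 2 ^ r.
(* Writing the bound over an arbitrary ring lets one formula serve as a polynomial and as a rational
   number. *)
pose g (R : nzRingType) (d : R) : R :=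
 (1 + (((d * (1 + (2 * k)%:R * d) * (1 + 2 * d) + 1) * k%:R) + 1) ^+ k)%R.
exists (g _ ('X + 1)%R) => T e [e_sym _] x [[H [h [_ _ xE]]] dens].
have x_ge0 : (0 <= x)%R by rewrite -xE divr_ge0.
(* [D] is an integer above [x] but at most [x + 1], which is why the polynomial is [g] at
   ['X + 1]. *)
pose D := (Num.truncn x).+1.
have leD : (D%:R <= x + 1)%R.
  by rewrite -natr1 lerD2r truncn_le.
have sparse M L : linkage e (2 * k) M L -> size L <= D * #|M|.
  move=> /(linkage_minor e_sym)[H' [h' [h's h'm cardH' leL]]].
  apply: leq_trans leL _; have := dens _ _ h's h'm.
  (* For empty [M] the density is 0 by convention and bounds nothing, so the absence of edges is
     checked directly. *)
  rewrite /density cardH' => le_x; have [M0|M0] := posnP #|M|.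
    rewrite (_ : #|edge_set h'| = 0) //; apply: eq_card0 => A.
    rewrite !inE; apply/existsP=> -[y _].
    exact: (fintype0 y (etrans cardH' M0)).
  rewrite -(ler_nat rat) natrM -ler_pdivrMr ?ltr0n //.
  by rewrite (le_trans le_x) // ltW // truncnS_gt.
have [rank [c [inj cm sep]]] := sparse_colouring e_sym (expn_gt0 2 r) sparse.
exists (edge_colour rank c); split; first exact: edge_colour_admissible.
have := ncolours_edge_colour e rank cm; rewrite -(ler_nat rat) -/k.
move/le_trans; apply.
have -> : ((g _ ('X + 1)).[x] = g rat (x + 1))%R.
  by rewrite /g !(hornerMn, hornerE).
have D_ge0 : (0 <= D%:R :> rat)%R by exact: ler0n.
have -> : (((((D * (1 + 2 * k * D) * (2 * D).+1).+1 * k).+1 ^ k).+1)%:R = g rat D%:R)%R.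
  rewrite /g -[in LHS]natr1 addrC natrX; congr (1 + _ ^+ k)%R.
  by rewrite -natr1 natrM -natr1 !natrM natrD !natrM -(nat1r (2 * D)) natrM.
have y_ge0 : (0 <= x + 1)%R by exact: le_trans leD.
(* All coefficients of [g] are nonnegative, so it is monotone on nonnegative arguments. *)
rewrite /g lerD2l lerXn2r ?nnegrE ?lerD2r ?ler_wpM2r ?lerD2r //;
  try by rewrite !(addr_ge0, mulr_ge0).
by rewrite !ler_pM ?lerD2l ?ler_wpM2l ?mulr_ge0 ?addr_ge0 ?mulr_ge0.
Qed.
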